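(* Let $G=(V,E)$ be a finite graph with at least one vertex and $k>0$ an integer. The following are equivalent: (i) $G$ has a blockage of order $k-1$; (ii) $G$ has an $\mathcal F_k^{(2)}$-tangle of $S_k$; (iii) $G$ has no $S_k$-tree over $\mathcal F_k^{(2)}$; (iv) $G$ has path-width at least $k-1$.
   Context: An (oriented vertex) separation of $G$ is a pair $(A,B)$ of (possibly empty) subsets of $V$ with $A\cup B=V$ and no edge between $A\setminus B$ and $B\setminus A$; $\vec U$ is the set of these, ordered by $(A,B)\le(C,D)$ iff $A\subseteq C$ and $B\supseteq D$, inverse $(B,A)$; $\{A,B\}$ is the unoriented separation, of order $|A\cap B|$. $\vec S_k$: oriented separations of order $<k$; $S_k$: unoriented ones. An orientation of $S_k$ is a set $O\subseteq\vec S_k$ containing exactly one of $(A,B),(B,A)$ for each $\{A,B\}\in S_k$; it is consistent if there are no $(A,B),(C,D)\in\vec S_k$ with $\{A,B\}\ne\{C,D\}$, $(A,B)<(C,D)$, $(B,A)\in O$, $(C,D)\in O$. A star is a set $\sigma$ of separations with $(A,B)\ne(B,A)$ for each element and $(A,B)\le(D,C)$ for distinct $(A,B),(C,D)\in\sigma$. $\mathcal F_k$ is the set of stars $\{(A_i,B_i):i=0,\dots,n\}\subseteq\vec U$ with $|\bigcap_{i=0}^nB_i|<k$ (intersection $=V$ for the empty star), and $\mathcal F_k^{(2)}=\{\sigma\in\mathcal F_k:|\sigma|\le2\}$. An $\mathcal F_k^{(2)}$-tangle of $S_k$ is a consistent orientation of $S_k$ with no subset in $\mathcal F_k^{(2)}$.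 An $S_k$-tree over $\mathcal F_k^{(2)}$ is a pair $(T,\alpha)$, $T$ a finite tree with at least one node, $\alpha$ assigning to each ordered pair $(x,y)$ with $xy\in E(T)$ an element $\alpha(x,y)\in\vec S_k$ with $\alpha(y,x)$ the inverse of $\alpha(x,y)$ and $\{\alpha(x,t):xt\in E(T)\}\in\mathcal F_k^{(2)}$ for every node $t$. For $X\subseteq V$, $\partial(X)$ is the set of vertices in $X$ with a neighbour outside $X$. A blockage of order $k-1$ is a collection $\mathcal B$ of subsets of $V$ such that: (B1) $|\partial(X)|<k$ for all $X\in\mathcal B$; (B2) $X'\in\mathcal B$ whenever $X'\subseteq X\in\mathcal B$ and $|\partial(X')|<k$; (B3) for every $\{X_1,X_2\}\in S_k$ exactly one of $X_1,X_2$ lies in $\mathcal B$. Path-width is the least width of a tree-decomposition whose decomposition tree is a path. *)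

(* Defs.v *)
From mathcomp Require Import all_boot.
From mathcomp Require Import boolp.

Set Implicit Arguments.
Unset Strict Implicit.
Unset Printing Implicit Defensive.

Record sgraph := SGraph {
  vertex :> finType;
  adj : rel vertex;
  adj_sym : symmetric adj;
  adj_irrefl : irreflexive adj }.

Definition connected (T : sgraph) : Prop := forall x y : T, connect (@adj T) x y.

Definition acyclic (T : sgraph) : Prop :=
  forall c : seq T, 2 < size c -> ~ ucycle (@adj T) c.

Definition is_tree (T : sgraph) : Prop := [/\ 0 < #|T|, connected T & acyclic T].

(* [T] is isomorphic to the graph on 0, ..., n whose edges join consecutive
   numbers; a path has at least one vertex. *)
Definition is_path (T : sgraph) : Prop :=
  exists (n : nat) (f : 'I_n.+1 -> T), bijective f /\
    forall i j, adj (f i) (f j) = (i.+1 == j :> nat) || (j.+1 == i :> nat).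

Definition osep (G : sgraph) : predArgType := ({set G} * {set G})%type.

Section Separations.
Variable G : sgraph.
Implicit Types (s r : osep G) (k : nat).

Definition oseps : {set osep G} :=
  [set s : osep G | (s.1 :|: s.2 == [set: G]) &&
     [forall x in s.1 :\: s.2, forall y in s.2 :\: s.1, ~~ adj x y]].

Definition inv s : osep G := (s.2, s.1).

Definition unoriented s : {set {set G}} := [set s.1; s.2].

Definition sep_le s r : bool := (s.1 \subset r.1) && (r.2 \subset s.2).

Definition sep_lt s r : bool := (s != r) && sep_le s r.

Definition order s : nat := #|s.1 :&: s.2|.

Definition vecS k : {set osep G} := [set s in oseps | order s < k].

(* Counting the elements of [O] in the set [{s, inv s}], rather than taking an
   exclusive or of two memberships, makes an orientation contain the
   self-inverse separation (V,V) when |V| < k. *)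
Definition orientation k (O : {set osep G}) : Prop :=
  O \subset vecS k /\ forall s, s \in vecS k -> #|O :&: [set s; inv s]| = 1.

Definition consistent k (O : {set osep G}) : Prop :=
  ~ exists s r : osep G,
      [/\ s \in vecS k /\ r \in vecS k, unoriented s != unoriented r,
          sep_lt s r, inv s \in O & r \in O].

Definition star (sigma : {set osep G}) : Prop :=
  [/\ sigma \subset oseps,
      forall s, s \in sigma -> s != inv s
    & forall s r, s \in sigma -> r \in sigma -> s != r -> sep_le s (inv r)].

Definition calF k (sigma : {set osep G}) : Prop :=
  star sigma /\ #|\bigcap_(s in sigma) s.2| < k.

Definition calF2 k (sigma : {set osep G}) : Prop :=
  calF k sigma /\ #|sigma| <= 2.

Definition tangle (F : {set osep G} -> Prop) k (O : {set osep G}) : Prop :=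
  [/\ orientation k O, consistent k O
    & forall sigma : {set osep G}, sigma \subset O -> ~ F sigma].

(* Values of [alpha] on pairs that are not edges of [T] are irrelevant. *)
Definition Stree_over (F : {set osep G} -> Prop) k
    (T : sgraph) (alpha : T -> T -> osep G) : Prop :=
  [/\ is_tree T,
      forall x y, adj x y -> alpha x y \in vecS k,
      forall x y, adj x y -> alpha y x = inv (alpha x y)
    & forall t, F [set alpha x t | x : T & adj x t]].

Definition boundary (X : {set G}) : {set G} :=
  [set x in X | [exists y, (y \notin X) && adj x y]].

(* Blockage of order k - 1.  As for orientations, the last clause counts the
   members of the set [{X1, X2}], which is a singleton when X1 = X2 = V. *)
Definition blockage k (B : {set {set G}}) : Prop :=
  [/\ forall X, X \in B -> #|boundary X| < k,
      forall X X' : {set G},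
        X \in B -> X' \subset X -> #|boundary X'| < k -> X' \in B
    & forall s, s \in vecS k -> #|B :&: [set s.1; s.2]| = 1].

End Separations.

Definition tree_decomposition (G T : sgraph) (W : T -> {set G}) : Prop :=
  [/\ is_tree T,
      \bigcup_t W t = [set: G],
      forall x y : G, adj x y -> exists t, (x \in W t) && (y \in W t)
    & forall (t1 t2 : T) (p : seq T),
        path (@adj T) t1 p -> uniq (t1 :: p) -> t2 \in t1 :: p ->
        W t1 :&: W (last t1 p) \subset W t2].

(* The truncated predecessor is the true width as soon as [G] has a vertex. *)
Definition width (G T : sgraph) (W : T -> {set G}) : nat :=
  (\max_t #|W t|).-1.

Definition has_path_decomposition (G : sgraph) (w : nat) : Prop :=
  exists (T : sgraph) (W : T -> {set G}),
    [/\ tree_decomposition W, is_path T & width W = w].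

Lemma path_decomposition_exists (G : sgraph) :
  exists w, `[< has_path_decomposition G w >].
Proof.
have s1 : @symmetric unit (fun _ _ => false) by [].
have s2 : @irreflexive unit (fun _ _ => false) by [].
pose T := SGraph s1 s2; pose W (t : T) := [set: G].
exists (width W); apply/asboolP; exists T, W; split => //.
  split.
  - split; first by rewrite card_unit.
    + by move=> [] []; exact: connect0.
    + by move=> [|[] [|[] c]] //= _ /andP[].
  - by apply/setP => x; rewrite inE; apply/bigcupP; exists tt; rewrite ?inE.
  - by move=> x y _; exists tt; rewrite !inE.
  - by move=> *; exact: subsetT.
exists 0, (fun=> tt); split; last by move=> i j; rewrite !ord1.
by exists (fun=> ord0) => [i|[]] //; rewrite ord1.
Qed.

Definition pathwidth (G : sgraph) : nat := ex_minn (path_decomposition_exists G).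

(* Main.v *)
(* The substantial implication is from (iv) to (i).  Two separations s <= r are
   linked by a step if they share a side.  A chain of steps of order < k from
   (0,V) to (V,0) is a path-decomposition of width < k - 1, with bags A :&: B,
   so large path-width rules out such a chain.  Take a maximal down-closed family
   F of separations, containing (0,V), such that no chain leads from an element
   of F to the inverse of one.  If c is not oriented by F, maximality yields a
   chain from a minimal unoriented m <= c to the inverse of an element of F, and
   one from an element of F to some n >= c with inv n minimal unoriented.  By
   submodularity both can be shifted to a separation of minimum order between m
   and n and then concatenated, which is a contradiction.  Hence F orients
   everything, and the first sides of its elements form a blockage.

   For the rest: a blockage B orients every separation towards the side outside
   B; a tangle orients the edges of an S_k-tree so that there is no sink; and
   cutting a path-decomposition between its bags gives an S_k-tree. *)
Require Import Defs.
From mathcomp Require Import all_boot.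
From mathcomp Require Import boolp zify.
(* [all_boot] also exports an [inv] and an [order]. *)
Import Defs.

Set Implicit Arguments.
Unset Strict Implicit.
Unset Printing Implicit Defensive.

Lemma card_setI2_eq1 (T : finType) (B : {set T}) (x y : T) :
  #|B :&: [set x; y]| = 1 <->
  (x \in B) || (y \in B) /\ (x \in B -> y \in B -> x = y).
Proof.
split=> [/eqP/cards1P[z /setP eB]|].
  have := eB z; rewrite !inE eqxx => /andP[zB zxy].
  split; first by case/orP: zxy => /eqP <-; rewrite zB ?orbT.
  move=> xB yB; have := eB x; have := eB y; rewrite !inE !eqxx xB yB orbT.
  by move=> /esym/eqP-> /esym/eqP->.
move=> [xyB eqxy].
have single u v : u \in B -> (v \in B -> u = v) -> #|B :&: [set u; v]| = 1.
  move=> uB uv; rewrite -(cards1 u); congr #|pred_of_set _|; apply/setP => z.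
  rewrite in_setI in_set2 in_set1; have [->|zu] /= := eqVneq z u; first by rewrite uB.
  by apply: contraNF zu => /andP[zB /eqP ev]; rewrite uv -ev.
case/orP: xyB => [xB|yB]; first by apply: single => // /eqxy->.
by rewrite setUC; apply: single => // /eqxy->.
Qed.

(** * Lattice of separations, submodularity of the order, boundaries *)

Section SeparationTheory.
Variable G : sgraph.
Implicit Types (s r c : osep G) (k : nat) (X Y : {set G}).

Lemma osepsP s :
  reflect ((forall x, (x \in s.1) || (x \in s.2)) /\
           (forall x y, x \notin s.2 -> y \notin s.1 -> ~~ adj x y))
          (s \in oseps G).
Proof.
rewrite inE; apply: (iffP andP) => [[/eqP cov /forall_inP sep]|[cov sep]].
  have cov' x : (x \in s.1) || (x \in s.2) by rewrite -in_setU cov inE.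
  split=> // x y xs2 ys1.
  have xs : x \in s.1 :\: s.2 by rewrite inE xs2; have := cov' x; rewrite (negPf xs2) orbF.
  have ys : y \in s.2 :\: s.1 by rewrite inE ys1; have := cov' y; rewrite (negPf ys1).
  by move/forall_inP: (sep x xs) => /(_ y ys).
split; first by apply/eqP/setP => x; rewrite !inE cov.
by apply/forall_inP => x /setDP[_ xs]; apply/forall_inP => y /setDP[_ ys]; apply: sep.
Qed.

Lemma invK : involutive (@inv G).
Proof. by case. Qed.

Lemma inv_oseps s : (inv s \in oseps G) = (s \in oseps G).
Proof.
suff imp r : r \in oseps G -> inv r \in oseps G.
  by apply/idP/idP => /imp; rewrite ?invK.
move=> /osepsP[cov sep]; apply/osepsP; split=> [x|x y xs ys] /=.
  by rewrite orbC.
by rewrite adj_sym; apply: sep.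
Qed.

Lemma order_inv s : order (inv s) = order s.
Proof. by rewrite /order setIC. Qed.

Lemma vecSE k s : (s \in vecS G k) = (s \in oseps G) && (order s < k).
Proof. by rewrite !inE. Qed.

Lemma inv_vecS k s : (inv s \in vecS G k) = (s \in vecS G k).
Proof. by rewrite !vecSE inv_oseps order_inv. Qed.

Lemma sep_le_refl : reflexive (@sep_le G).
Proof. by move=> s; rewrite /sep_le !subxx. Qed.

Lemma sep_le_trans : transitive (@sep_le G).
Proof.
move=> r s c /andP[sr1 sr2] /andP[rc1 rc2].
by rewrite /sep_le (subset_trans sr1 rc1) (subset_trans rc2 sr2).
Qed.

Lemma sep_le_inv s r : sep_le (inv s) (inv r) = sep_le r s.
Proof. by rewrite /sep_le andbC. Qed.

Definition meet s r : osep G := (s.1 :&: r.1, s.2 :|: r.2).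
Definition join s r : osep G := (s.1 :|: r.1, s.2 :&: r.2).

Lemma meet_oseps s r : s \in oseps G -> r \in oseps G -> meet s r \in oseps G.
Proof.
move=> /osepsP[covs seps] /osepsP[covr sepr]; apply/osepsP; split=> [x|x y] /=.
  rewrite !inE; case: (x \in s.1) (covs x) (covr x) => /= [_|->] //.
  by case: (x \in r.1) => //= ->; rewrite orbT.
rewrite !inE negb_or negb_and => /andP[xs xr] /orP[ys|yr]; first exact: seps.
exact: sepr.
Qed.

Lemma join_oseps s r : s \in oseps G -> r \in oseps G -> join s r \in oseps G.
Proof.
move=> ss rr; rewrite -inv_oseps.
by apply: (@meet_oseps (inv s) (inv r)); rewrite inv_oseps.
Qed.

Lemma card_osep s : s \in oseps G -> #|s.1| + #|s.2| = #|G| + order s.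
Proof.
move=> /osepsP[cov _]; rewrite -cardsUI -cardsT; congr (#|pred_of_set _| + _).
by apply/setP => x; rewrite !inE cov.
Qed.

(** By [card_osep] the order is |A| + |B| - |V|, so inclusion-exclusion on first and on second sides
    gives equality. *)
Lemma order_modular s r : s \in oseps G -> r \in oseps G ->
  order (meet s r) + order (join s r) = order s + order r.
Proof.
move=> ss rr.
have := card_osep (meet_oseps ss rr); have := card_osep (join_oseps ss rr).
have := card_osep ss; have := card_osep rr.
have /= := cardsUI s.1 r.1; have /= := cardsUI s.2 r.2.
lia.
Qed.

Lemma sep_le_meetl s r : sep_le (meet s r) s.
Proof. by rewrite /sep_le subsetIl subsetUl. Qed.

Lemma meet_idPr s r : sep_le r s -> meet s r = r.
Proof.
case: r => r1 r2 /andP[/= r1s sr2].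
by congr pair; [apply/setIidPr | apply/setUidPr].
Qed.

Lemma sep_set0T : (set0, setT) \in oseps G.
Proof. by apply/osepsP; split=> [x|x y]; rewrite !inE. Qed.

Lemma order_set0T : order (set0 : {set G}, setT : {set G}) = 0.
Proof. by rewrite /order set0I cards0. Qed.

Lemma set0T_vecS k : 0 < k -> (set0, setT) \in vecS G k.
Proof. by move=> k0; rewrite vecSE sep_set0T order_set0T. Qed.

Lemma set0T_le s : sep_le (set0, setT) s.
Proof. by rewrite /sep_le sub0set subsetT. Qed.

Lemma sep_le_anti s r : sep_le s r -> sep_le r s -> s = r.
Proof.
case: s r => s1 s2 [r1 r2] /andP[/= a b] /andP[/= c d].
by congr pair; apply/eqP; rewrite eqEsubset ?a ?b ?c ?d.
Qed.

(* The order of (r.1, s.2) is the size of the intersection s.2 :&: (inv r).2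
   that belongs to the star {s, inv r}. *)
Lemma nested_oseps s r : s \in oseps G -> r \in oseps G -> sep_le s r ->
  (r.1, s.2) \in oseps G.
Proof.
move=> /osepsP[covs seps] /osepsP[covr sepr] /andP[le1 le2].
apply/osepsP; split=> [x|x y /= xs yr] /=.
  by case/orP: (covs x) => [/(subsetP le1)->|->]; rewrite ?orbT.
by apply: sepr => //; apply: contra xs => /(subsetP le2).
Qed.

Lemma boundary_sub_sep s : s \in oseps G -> boundary s.1 \subset s.1 :&: s.2.
Proof.
move=> /osepsP[_ sep]; apply/subsetP => x; rewrite !inE => /andP[-> /=].
move=> /existsP[y /andP[ys xy]]; apply: contraLR xy => xs; exact: sep.
Qed.

Lemma boundary_order k s : s \in vecS G k -> #|boundary s.1| < k.
Proof.
by rewrite vecSE => /andP[/boundary_sub_sep/subset_leq_card + sk] => /leq_ltn_trans->.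
Qed.

(** Among the separations with first side [X], the one with the smallest second side, hence the
    greatest in [sep_le]. *)
Definition small_sep X : osep G := (X, ~: X :|: boundary X).

Lemma small_sep_oseps X : small_sep X \in oseps G.
Proof.
apply/osepsP; split=> [x|x y] /=; rewrite !inE; first by case: (x \in X).
rewrite negb_or negbK => /andP[xX]; rewrite xX /= negb_exists => /forallP/(_ y).
by rewrite negb_and negbK => /orP[->|//].
Qed.

Lemma order_small_sep X : order (small_sep X) = #|boundary X|.
Proof.
rewrite /order /=; congr #|pred_of_set _|; apply/setP => x.
by rewrite !inE; case: (x \in X).
Qed.

Lemma small_sep_le X Y : X \subset Y -> sep_le (small_sep X) (small_sep Y).
Proof.
move=> XY; rewrite /sep_le XY; apply/subsetP => x; rewrite !inE.
case: (boolP (x \in X)) => //= xX; rewrite (subsetP XY) //=.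
case/existsP=> y /andP[yY xy]; apply/existsP; exists y; rewrite xy andbT.
by apply: contra yY; apply: (subsetP XY).
Qed.

Lemma small_sep_max s : s \in oseps G -> (small_sep s.1).2 \subset s.2.
Proof.
move=> ss; apply/subsetP => x; rewrite !inE => /orP[xs1|].
  by have /osepsP[/(_ x)] := ss; rewrite (negPf xs1).
move=> xb; have /subsetP/(_ x) := boundary_sub_sep ss; rewrite !inE.
by move=> /(_ xb)/andP[].
Qed.

End SeparationTheory.

(** * Chains of steps, and a blockage when none joins (0,V) to (V,0) *)

Section Reachability.
Variables (G : sgraph) (k : nat).
Implicit Types (s r c d : osep G) (A : {set osep G}).

(* A two-element star {s, inv r} of F_k with s <= r splits into the two steps
   s -> (r.1, s.2) -> r; the elementary steps are preserved by meets. *)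
Definition step : rel (osep G) := fun s r =>
  [&& s \in vecS G k, r \in vecS G k, sep_le s r & (s.1 == r.1) || (s.2 == r.2)].

Lemma step_inv s r : step (inv r) (inv s) = step s r.
Proof.
rewrite /step !inv_vecS sep_le_inv /= andbCA; do 3! congr andb.
by rewrite orbC eq_sym [r.2 == _]eq_sym.
Qed.

Lemma connect_step_inv s r : connect step s r -> connect step (inv r) (inv s).
Proof.
case/connectP=> p + ->; elim: p s => [|c p IH] s //= /andP[sc cp].
by apply: connect_trans (IH _ cp) (connect1 _); rewrite step_inv.
Qed.

Lemma connect_step_le s r : connect step s r -> sep_le s r.
Proof.
case/connectP=> p + ->; elim: p s => [|c p IH] s /=; first by rewrite sep_le_refl.
by case/andP=> /and4P[_ _ sc _] /IH; apply: sep_le_trans.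
Qed.

Lemma star_connect s r : s \in vecS G k -> r \in vecS G k -> sep_le s r ->
  #|s.2 :&: r.1| < k -> connect step s r.
Proof.
move=> sS rS sr ord; have [ss _] := andP (etrans (esym (vecSE _ _)) sS).
have [rr _] := andP (etrans (esym (vecSE _ _)) rS).
have mS : (r.1, s.2) \in vecS G k by rewrite vecSE nested_oseps //= /order setIC.
have [sr1 sr2] := andP sr.
apply: (@connect_trans _ _ (r.1, s.2)); apply: connect1.
  by rewrite /step sS mS /sep_le /= sr1 subxx eqxx orbT.
by rewrite /step rS mS /sep_le /= sr2 subxx eqxx.
Qed.

(** Replace each [t] on the chain by [meet t c]. As [join t c] lies between [c] and [r], its order
    is at least that of [c], so by modularity the order of [meet t c] is at most that of [t]. The
    end [r] becomes [c]. *)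
Lemma shift_connect s r c : c \in vecS G k -> sep_le c r -> s \in vecS G k ->
    (forall d, d \in oseps G -> sep_le c d -> sep_le d r -> order c <= order d) ->
  connect step s r -> connect step (meet s c) c.
Proof.
move=> cS cr sS cmin /connectP[p + er].
have [cc _] := andP (etrans (esym (vecSE _ _)) cS).
have meetS t : t \in vecS G k -> sep_le t r -> meet t c \in vecS G k.
  rewrite !vecSE => /andP[tt tk] tr; rewrite meet_oseps //=.
  apply: leq_ltn_trans tk; have := order_modular tt cc.
  suff : order c <= order (join t c) by lia.
  apply: cmin; first exact: join_oseps.
    by rewrite /sep_le subsetUr subsetIr.
  by move: tr cr; rewrite /sep_le subUset subsetI => /andP[-> ->] /andP[-> ->].
elim: p s sS er => [|t p IH] s sS /= er; first by rewrite -er meet_idPr.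
case/andP=> st tp; have [_ tS ht hs] := and4P st.
apply: connect_trans (IH t tS er tp); apply: connect1.
have tr : sep_le t r by apply: connect_step_le; apply/connectP; exists p.
rewrite /step !meetS ?(sep_le_trans ht tr) //=.
case/andP: ht => h1 h2; rewrite /sep_le setSI //= setSU //=.
by case/orP: hs => /eqP->; rewrite eqxx ?orbT.
Qed.

Definition down_closed A :=
  [forall s in A, forall r in vecS G k, sep_le r s ==> (r \in A)].

(** As [connect] is reflexive, such a family never contains a separation together with its
    inverse. *)
Definition unlinked A :=
  [forall s in A, forall r in A, ~~ connect step s (inv r)].

Lemma down_closedP A :
  reflect (forall s r, s \in A -> r \in vecS G k -> sep_le r s -> r \in A)
          (down_closed A).
Proof.
apply: (iffP forall_inP) => [cl s r /cl/forall_inP h /h/implyP|cl s sA].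
  exact.
by apply/forall_inP => r rS; apply/implyP; apply: cl rS.
Qed.

Lemma unlinkedP A :
  reflect (forall s r, s \in A -> r \in A -> ~~ connect step s (inv r))
          (unlinked A).
Proof.
apply: (iffP forall_inP) => [cl s r /cl/forall_inP h /h|cl s sA].
  by [].
by apply/forall_inP => r; apply: cl.
Qed.

Definition small_family A :=
  [&& A \subset vecS G k, (set0, setT) \in A, down_closed A & unlinked A].

Section MaximalFamily.
Variable A : {set osep G}.
Hypothesis maxA : maxset small_family A.

Let famA : small_family A. Proof. by case/maxsetP: maxA. Qed.
Let subA : {subset A <= vecS G k}. Proof. by apply/subsetP; case/and4P: famA. Qed.
Let botA : (set0, setT) \in A. Proof. by case/and4P: famA. Qed.
Let downA s r : s \in A -> r \in vecS G k -> sep_le r s -> r \in A.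
Proof. by have [_ _ /down_closedP h _] := and4P famA; apply: h. Qed.
Let unlA s r : s \in A -> r \in A -> ~~ connect step s (inv r).
Proof. by have [_ _ _ /unlinkedP h] := and4P famA; apply: h. Qed.

Definition unoriented_in : {set osep G} :=
  [set s in vecS G k | (s \notin A) && (inv s \notin A)].

(** By minimality everything of order < k strictly below [m] is in [A], so [m |: A] is down-closed;
    by maximality of [A] it can then only fail to be unlinked. *)
Lemma minimal_unoriented_linked m : m \in unoriented_in ->
    (forall d, d \in unoriented_in -> sep_le d m -> d = m) ->
  exists2 r, r \in A & connect step m (inv r).
Proof.
rewrite inE => /and3P[mS mA imA] mmin.
have below d : d \in vecS G k -> sep_le d m -> d != m -> d \in A.
  move=> dS dm; apply: contraNT => dA; apply/eqP/mmin => //.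
  rewrite inE dS dA /=; apply: contra imA => idA.
  by apply: downA idA _ _; rewrite ?inv_vecS ?sep_le_inv.
have [/existsP[r /andP[rA mr]]|/existsPn noA] :=
  boolP [exists r, (r \in A) && connect step m (inv r)]; first by exists r.
have noA' r : r \in A -> ~~ connect step m (inv r).
  by move=> rA; have := noA r; rewrite rA.
(* A chain from [m] to [inv m] makes [m.1] a subset of [m.2], so [m.2] is V and |[m.1]| < k. Then
   (0,V) reaches [m], hence via [inv m] also (V,0), against [unlA]. *)
have noself : ~~ connect step m (inv m).
  apply/negP => mm; have /andP[/= m12 _] := connect_step_le mm.
  have mT : m.2 = setT.
    move: mS; rewrite vecSE => /andP[/osepsP[cov _] _]; apply/setP => x.
    by rewrite inE; case/orP: (cov x) => // /(subsetP m12).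
  have bm : connect step (set0, setT) m.
    apply: star_connect => //; [exact: subA|exact: set0T_le|].
    by move: mS; rewrite vecSE => /andP[_]; rewrite /order mT setTI setIT.
  have /negP := unlA botA botA; apply.
  exact: connect_trans (connect_trans bm mm) (connect_step_inv bm).
have famM : small_family (m |: A).
  rewrite /small_family subUset sub1set mS; apply/and4P; split.
  - by apply/subsetP.
  - by rewrite inE botA orbT.
  - apply/down_closedP => s r; rewrite !in_setU1 => /predU1P[->|sA] rS rs.
      by have [//|rm] := eqVneq r m; rewrite below.
    by rewrite (downA sA) ?orbT.
  - apply/unlinkedP => s r; rewrite !in_setU1 => /predU1P[->|sA] /predU1P[->|rA] //.
    + exact: noA'.
    + apply: contra (noA' s sA) => /connect_step_inv; by rewrite invK.
    + exact: unlA.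
have [_ /(_ _ famM (subsetUr _ _)) eA] := maxsetP maxA.
by move: mA; rewrite -eA !inE eqxx.
Qed.

Lemma minimal_unoriented c : c \in unoriented_in -> exists m,
  [/\ m \in unoriented_in, sep_le m c &
      forall d, d \in unoriented_in -> sep_le d m -> d = m].
Proof.
move=> cU; pose P := [pred d | (d \in unoriented_in) && sep_le d c].
have Pc : P c by rewrite /= cU sep_le_refl.
(* This sum strictly increases along [sep_le], so a minimiser is a minimal element. *)
case: (arg_minnP (fun d : osep G => #|d.1| + #|~: d.2|) Pc) => m /andP[mU mc] mmin.
exists m; split=> // d dU dm.
have := mmin d; rewrite /= dU (sep_le_trans dm mc) => /(_ isT) le.
case/andP: (dm) => d1 d2; move: (d2); rewrite -setCS => d2'.
have c1 := subset_leq_card d1; have c2 := subset_leq_card d2'.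
have e1 : d.1 = m.1.
  apply/eqP; rewrite eqEcard d1 /= -(leq_add2r #|~: m.2|).
  by apply: leq_trans le _; rewrite leq_add2l.
have e2 : ~: d.2 = ~: m.2.
  apply/eqP; rewrite eqEcard d2' /= -(leq_add2l #|m.1|).
  by apply: leq_trans le _; rewrite leq_add2r.
by apply: sep_le_anti; rewrite // /sep_le e1 -[m.2]setCK -e2 setCK !subxx.
Qed.

Lemma inv_unoriented_in c : (inv c \in unoriented_in) = (c \in unoriented_in).
Proof.
by rewrite [LHS]in_set [RHS]in_set inv_vecS invK [X in _ && X]andbC.
Qed.

Lemma maximal_oriented c : c \in vecS G k -> (c \in A) || (inv c \in A).
Proof.
move=> cS; apply: contraT; rewrite negb_or => cA.
have cU : c \in unoriented_in by rewrite inE cS.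
have [m [mU mc /(minimal_unoriented_linked mU)[r rA mr]]] := minimal_unoriented cU.
have icU : inv c \in unoriented_in by rewrite inv_unoriented_in.
(* Here [n] is minimal below [inv c], so [c] lies between [m] and [inv n]; inverting [nt] gives a
   chain from [t] to [inv n]. *)
have [n [nU nc /(minimal_unoriented_linked nU)[t tA nt]]] := minimal_unoriented icU.
have cn : sep_le c (inv n) by rewrite -sep_le_inv invK.
pose P := [pred d | [&& d \in oseps G, sep_le m d & sep_le d (inv n)]].
have mS : m \in vecS G k by move: mU; rewrite inE => /andP[].
have Pm : P m.
  by move: mS; rewrite /= vecSE sep_le_refl (sep_le_trans mc cn) => /andP[->].
(* Minimum order between [m] and [inv n] lets [shift_connect] apply both to [d] below [inv n] and to
   [inv d] below [inv m]. *)
case: (arg_minnP (@order G) Pm) => d /and3P[dd md dn] dmin.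
have dS : d \in vecS G k.
  by move: mS; rewrite !vecSE dd => /andP[_]; apply: leq_ltn_trans; apply: dmin.
have low : connect step (meet t d) d.
  apply: (@shift_connect t (inv n)) => //; first exact: subA.
    move=> b bb db bn; apply: dmin; rewrite /= bb bn andbT.
    exact: sep_le_trans db.
  by rewrite -[t]invK; apply: connect_step_inv.
have high : connect step (meet r (inv d)) (inv d).
  apply: (@shift_connect r (inv m)); rewrite ?inv_vecS ?sep_le_inv //; first exact: subA.
    move=> b bb db bm; rewrite order_inv -(order_inv b); apply: dmin.
    rewrite /= inv_oseps bb -[m]invK sep_le_inv bm /=.
    by apply: sep_le_trans dn; rewrite -sep_le_inv invK.
  by rewrite -[r]invK; apply: connect_step_inv.
(* Only the order of [meet a b] needs a bound: it comes from the first step of the chain, or from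
   [b] if the chain is empty. *)
have inA a b : a \in A -> connect step (meet a b) b -> b \in vecS G k -> meet a b \in A.
  move=> aA /connectP[[|q p] /=]; last first.
    case/andP=> /andP[abS _] _ _ _; apply: downA aA abS _; exact: sep_le_meetl.
  by move=> _ eb bS; apply: downA aA _ (sep_le_meetl _ _); rewrite -eb.
have := unlA (inA _ _ tA low dS) (inA _ _ rA high _); rewrite inv_vecS dS => /(_ isT).
rewrite (connect_trans low) //; have := connect_step_inv high.
by rewrite invK.
Qed.

(** With [s], also [small_sep s.1] is in [A]: one step leads to it from [s], which excludes its
    inverse. Every separation with the same first side lies below it, so for order < k membership in
    [A] depends only on the first side. *)
Lemma maximal_blockage : blockage k [set s.1 | s in A].
Proof.
have small s : s \in A -> small_sep s.1 \in A.
  move=> sA; have sS := subA sA.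
  have ss : s \in oseps G by move: sS; rewrite vecSE => /andP[].
  have mS : small_sep s.1 \in vecS G k.
    by rewrite vecSE small_sep_oseps order_small_sep (boundary_order sS).
  case/orP: (maximal_oriented mS) => // iA.
  have /negP[] := unlA sA iA; rewrite invK; apply: connect1.
  by rewrite /step sS mS /sep_le /= eqxx subxx small_sep_max.
split=> [X /imsetP[s /subA sS ->]|X X' /imsetP[s sA ->] sub bd|s sS].
- exact: boundary_order.
- apply/imsetP; exists (small_sep X') => //; apply: downA (small _ sA) _ _.
    by rewrite vecSE small_sep_oseps order_small_sep.
  exact: small_sep_le.
have memE t : t \in vecS G k -> (t.1 \in [set s.1 | s in A]) = (t \in A).
  move=> tS; apply/imsetP/idP => [[r rA e]|tA]; last by exists t.
  case/orP: (maximal_oriented tS) => // itA.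
  have tt : t \in oseps G by move: tS; rewrite vecSE => /andP[].
  apply: downA (small _ rA) tS _; rewrite -e.
  by rewrite /sep_le subxx small_sep_max.
have iS : inv s \in vecS G k by rewrite inv_vecS.
have one t : t \in A -> inv t \notin A.
  by move=> tA; apply/negP => itA; have := unlA tA itA; rewrite invK connect0.
apply/card_setI2_eq1; have := memE (inv s) iS; rewrite (memE s sS) /= => ->.
split; first exact: maximal_oriented.
by move=> sA isA; have := one s sA; rewrite isA.
Qed.

End MaximalFamily.

(** Without such a chain the singleton of (0,V) is a [small_family]; a maximal one above it gives
    the blockage. *)
Lemma unreachable_blockage : 0 < k ->
    ~~ connect step (set0, setT) (setT, set0) ->
  exists B : {set {set G}}, blockage k B.
Proof.
move=> k0 nc.
have fam : small_family [set (set0, setT)].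
  apply/and4P; split; rewrite ?set11 ?sub1set ?set0T_vecS //.
    apply/down_closedP => s r; rewrite !inE => /eqP-> _ r0.
    by apply/eqP/sep_le_anti => //; apply: set0T_le.
  by apply/unlinkedP => s r; rewrite !inE => /eqP-> /eqP->.
have [A maxA _] := maxset_exists fam.
by eexists; apply: maximal_blockage maxA.
Qed.

End Reachability.

(** * Graphs whose vertices are numbered as along a path *)

Section PositionedGraph.
Variables (T : sgraph) (pos : T -> nat).
Hypothesis pos_inj : injective pos.
Hypothesis pos_adj : forall x y : T, adj x y = ((pos x).+1 == pos y) || ((pos y).+1 == pos x).

(** A discrete intermediate value argument: each edge changes [pos] by exactly one. *)
Lemma path_covers_between (x v : T) (p : seq T) : path (@adj T) x p ->
    (pos x <= pos v <= pos (last x p)) || (pos (last x p) <= pos v <= pos x) ->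
  v \in x :: p.
Proof.
elim: p x => [|y p IH] x /=.
  by move=> _ h; rewrite inE; apply/eqP/pos_inj; lia.
case/andP=> xy yp h; rewrite in_cons; have [//|/eqP vx /=] := eqVneq v x.
have {}vx : pos v <> pos x by move/pos_inj.
by apply: IH => //; move: xy; rewrite pos_adj; lia.
Qed.

(** Split the path at [v]. If [v] were outside the interval, the part before it would pass through
    the last vertex or the part after it through [x], repeating a vertex. *)
Lemma uniq_path_between (x v : T) (p : seq T) : path (@adj T) x p ->
    uniq (x :: p) -> v \in x :: p ->
  (pos x <= pos v <= pos (last x p)) || (pos (last x p) <= pos v <= pos x).
Proof.
rewrite in_cons => xp up /predU1P[->|vp]; first by lia.
case/path.splitP: vp xp up => p1 p2; rewrite cat_path last_cat last_rcons.
case/andP=> xp1 vp2 up; apply: contraT => nb.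
have [ep2|p2N] := eqVneq p2 [::]; first by move: nb; rewrite ep2 /=; lia.
have lp2 : last v p2 \in p2 by case: p2 p2N {vp2 up nb} => //= z p2 _; exact: mem_last.
have dis z : z \in x :: rcons p1 v -> z \notin p2.
  move: up; rewrite -cat_cons cat_uniq => /and3P[_ /hasPn h _].
  by apply: contraL => /h.
have vx : v != x.
  by move: up; rewrite /= mem_cat mem_rcons in_cons negb_or; case: eqVneq => // ->; rewrite eqxx.
have [hl|hl] := boolP ((pos x <= pos (last v p2) <= pos v) || (pos v <= pos (last v p2) <= pos x)).
  have := path_covers_between (v := last v p2) xp1.
  by rewrite last_rcons => /(_ hl)/dis; rewrite lp2.
have : x \in v :: p2 by apply: path_covers_between => //; lia.
by rewrite in_cons eq_sym (negPf vx) /= => xp2; have := dis _ (mem_head _ _); rewrite xp2.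
Qed.

(** On a cycle, both neighbours of the vertex of largest position have the position just below, so
    they coincide. *)
Lemma positioned_acyclic : acyclic T.
Proof.
move=> c c2 /andP[cyc uc].
have /hasP[z0 z0c _] : has predT c by case: c c2 {cyc uc}.
case: (arg_maxnP pos (z0c : [pred z | z \in c] z0)) => x /= xc xmax.
have [i s ec] := rot_to xc.
have : cycle (@adj T) (x :: s) by rewrite -ec rot_cycle.
have : uniq (x :: s) by rewrite -ec rot_uniq.
have : size (x :: s) = size c by rewrite -ec size_rot.
have : {subset s <= c} by move=> z zs; rewrite -(mem_rot i) ec in_cons zs orbT.
case: s {ec} => [|y [|z s]] sub sz; [by move: sz c2 => /= <-|by move: sz c2 => /= <-|].
move=> /= /and3P[_ ys _]; rewrite rcons_path => /and4P[xy _ _ lx].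
have yc : pos y <= pos x by apply/xmax/sub/mem_head.
have lc : pos (last z s) <= pos x by apply/xmax/sub; rewrite in_cons mem_last orbT.
have /pos_inj ey : pos y = pos (last z s).
  move: xy lx yc lc; rewrite !pos_adj.
  by move: (pos x) (pos y) (pos (last z s)) => a b d; lia.
by move: ys; rewrite ey mem_last.
Qed.

End PositionedGraph.

Definition path_adj n : rel 'I_n.+1 := fun i j => (i.+1 == j) || (j.+1 == i).

Lemma path_adj_sym n : symmetric (@path_adj n).
Proof. by move=> i j; rewrite /path_adj orbC. Qed.

Lemma path_adj_irrefl n : irreflexive (@path_adj n).
Proof. by move=> i; rewrite /path_adj; lia. Qed.

Definition path_graph n := SGraph (@path_adj_sym n) (@path_adj_irrefl n).

Lemma path_graph_is_path n : is_path (path_graph n).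
Proof. by exists n, id; split=> //; exists id. Qed.

Lemma path_graph_is_tree n : is_tree (path_graph n).
Proof.
split; first by rewrite card_ord.
- have from0 m (lt_m : m < n.+1) : connect (@path_adj n) ord0 (Ordinal lt_m).
    elim: m lt_m => [|m IH] lt_m.
      by rewrite (_ : Ordinal lt_m = ord0) ?connect0 //; apply: val_inj.
    apply: connect_trans (IH (ltnW lt_m)) (connect1 _).
    by rewrite /path_adj /= eqxx.
  move=> [i lt_i] [j lt_j]; apply: connect_trans (from0 j lt_j).
  by rewrite (sym_connect_sym (@path_adj_sym n)).
- by apply: (@positioned_acyclic (path_graph n) val) => //; exact: val_inj.
Qed.

(** * From a chain of steps to a path-decomposition *)

Section PathDecompositions.
Variable G : sgraph.

Lemma pathwidth_le w : has_path_decomposition G w -> pathwidth G <= w.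
Proof. by move=> pd; rewrite /pathwidth; case: ex_minnP => m _; apply; apply/asboolP. Qed.

Lemma pathwidth_decomposition : has_path_decomposition G (pathwidth G).
Proof. by rewrite /pathwidth; case: ex_minnP => m /asboolP. Qed.

Lemma reachable_pathwidth k : 0 < #|G| ->
  connect (@step G k) (set0, setT) (setT, set0) -> pathwidth G < k - 1.
Proof.
move=> /card_gt0P[x0 _] /connectP[p sp ep].
set b : osep G := (set0, setT) in sp ep.
have bS : b \in vecS G k.
  case: p sp ep => [_ /= [/setP/(_ x0)]|r p /= /andP[/and4P[] //]].
  by rewrite !inE.
pose S i := nth b (b :: p) i.
have stepS i : i < size p -> step k (S i) (S i.+1) by move/(pathP b): sp; apply.
have Slast : S (size p) = (setT, set0) by rewrite /S nth_last.
have mono i j : i <= j <= size p -> sep_le (S i) (S j).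
  case/andP=> + jp; elim: j jp => [|j IH] jp; first by rewrite leqn0 => /eqP->; apply: sep_le_refl.
  rewrite leq_eqVlt => /predU1P[->|ij]; first exact: sep_le_refl.
  by apply: sep_le_trans (IH (ltnW jp) ij) _; case/and4P: (stepS j jp).
have SS i : i <= size p -> S i \in vecS G k.
  by case: i => [_|i /stepS/and4P[] //].
pose W (t : path_graph (size p)) := (S t).1 :&: (S t).2.
have ltW t : #|W t| < k.
  by have := SS t; rewrite -ltnS ltn_ord vecSE => /(_ isT)/andP[].
(* At the first index where x or y has left the second side, only that side has
   changed, so both vertices lie in the preceding bag. *)
have covered x y : x = y \/ adj x y -> exists t, (x \in W t) && (y \in W t).
  have sym_case x' y' i : i < size p -> (forall u, u \in [:: x'; y'] -> u \in (S i).2) ->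
      x' \notin (S i.+1).2 -> x' = y' \/ adj x' y' -> x' \in (S i).1 /\ y' \in (S i).1.
    move=> ip inS x'S xy; have /and4P[_ _ _ /orP[/eqP e1|/eqP e2]] := stepS i ip; last first.
      by rewrite -e2 inS ?mem_head // in x'S.
    rewrite e1; have := SS _ ip; rewrite vecSE => /andP[/osepsP[cov sep] _].
    have x'1 : x' \in (S i.+1).1 by have := cov x'; rewrite (negPf x'S) orbF.
    split=> //; case: xy => [<- //|]; apply: contraTT; exact: sep.
  move=> xy; have ex : exists i, (x \notin (S i).2) || (y \notin (S i).2).
    by exists (size p); rewrite Slast !inE.
  case: (ex_minnP ex) => -[|i]; first by rewrite !inE.
  move=> out imin.
  have ip : i < size p by apply: (imin (size p)); rewrite Slast !inE.
  have inS u : u \in [:: x; y] -> u \in (S i).2.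
    have : ~~ ((x \notin (S i).2) || (y \notin (S i).2)).
      by apply/negP => /imin; rewrite ltnn.
    by rewrite negb_or !negbK !inE => /andP[xi yi] /orP[/eqP->|/eqP->].
  have lti : i < (size p).+1 by apply: ltnW.
  exists (Ordinal lti); rewrite !in_setI /= !inS ?inE ?eqxx ?orbT // !andbT.
  case/orP: out => out; first by have [-> ->] := sym_case x y i ip inS out xy.
  have yx : y = x \/ adj y x by case: xy => [->|]; [left|rewrite adj_sym; right].
  have inS' u : u \in [:: y; x] -> u \in (S i).2.
    by move=> uyx; apply: inS; move: uyx; rewrite !inE orbC.
  by have [-> ->] := sym_case y x i ip inS' out yx.
have pd : has_path_decomposition G (width W).
  exists (path_graph (size p)), W; split=> //; last exact: path_graph_is_path.
  split; first exact: path_graph_is_tree.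
  - apply/setP => x; rewrite inE; apply/bigcupP.
    by have [|t /andP[xt _]] := covered x x; [left|exists t].
  - by move=> x y xy; apply: covered; right.
  - move=> t1 t2 q q1 uq q2; have :=
      @uniq_path_between (path_graph (size p)) val val_inj (fun x y => erefl)
        _ _ _ q1 uq q2.
    have conv (i j l : path_graph (size p)) : i <= j <= l -> W i :&: W l \subset W j.
      case/andP=> ij jl; apply/subsetP => x; rewrite !inE => /andP[/andP[xi _] /andP[_ xl]].
      have lp : l <= size p by rewrite -ltnS.
      have /andP[/subsetP-> // _] : sep_le (S i) (S j) by apply: mono; rewrite ij (leq_trans jl).
      by have /andP[_ /subsetP->] : sep_le (S j) (S l) by apply: mono; rewrite jl.
    by case/orP=> /conv //; rewrite setIC.
apply: leq_ltn_trans (pathwidth_le pd) _; rewrite /width.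
have [|t /andP[xt _]] := covered x0 x0; first by left.
(* Excludes the truncated case of [.-1], in which width 0 would not be below [k - 1] for [k = 1]. *)
have W1 : 0 < \max_t #|W t|.
  by apply: leq_trans (leq_bigmax t); apply/card_gt0P; exists x0.
have Wk : \max_t #|W t| <= k.-1.
  by apply/bigmax_leqP => u _; have := ltW u; lia.
lia.
Qed.

End PathDecompositions.

(** * From a path-decomposition to an S_k-tree *)

Section TreeFromDecomposition.
Variables (G T : sgraph) (k : nat) (W : T -> {set G}) (pos : T -> nat).
Hypothesis tdW : tree_decomposition W.
Hypothesis ltWk : forall t, #|W t| < k.
Hypothesis leGk : k <= #|G|.
Hypothesis pos_inj : injective pos.
Hypothesis pos_adj : forall x y : T, adj x y = ((pos x).+1 == pos y) || ((pos y).+1 == pos x).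
Hypothesis pos_down : forall t m, m <= pos t -> exists u, pos u = m.

Lemma bag_convex t1 t t2 : pos t1 <= pos t <= pos t2 -> W t1 :&: W t2 \subset W t.
Proof.
move=> le; have [[_ conn _] _ _ conv] := tdW.
have /connectP[p tp] := conn t1 t2; case/shortenP: tp => q tq uq _ et2.
rewrite et2; apply: (conv _ _ _ tq uq).
by apply: (path_covers_between pos_inj pos_adj tq); rewrite -et2 le.
Qed.

Definition cut i : osep G :=
  (\bigcup_(t | pos t < i) W t, \bigcup_(t | i <= pos t) W t).

Lemma in_cut1 i x : reflect (exists2 t, pos t < i & x \in W t) (x \in (cut i).1).
Proof. exact: bigcupP. Qed.

Lemma in_cut2 i x : reflect (exists2 t, i <= pos t & x \in W t) (x \in (cut i).2).
Proof. exact: bigcupP. Qed.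

Lemma in_some_bag x : exists t, x \in W t.
Proof.
have [_ /setP/(_ x) + _ _] := tdW; rewrite inE => /bigcupP[t _ xt]; by exists t.
Qed.

(** A vertex on both sides is in a bag before [t] and in one at or after [t], hence in [W t] by
    convexity; an edge lies within one bag, hence within one side. *)
Lemma cut_vecS t : cut (pos t) \in vecS G k.
Proof.
rewrite vecSE; apply/andP; split.
  apply/osepsP; split=> [x|x y].
    have [u xu] := in_some_bag x; case: (ltnP (pos u) (pos t)) => ut.
      by apply/orP; left; apply/in_cut1; exists u.
    by apply/orP; right; apply/in_cut2; exists u.
  move=> /in_cut2 xN /in_cut1 yN; apply/negP => xy.
  have [_ _ /(_ x y xy)[u /andP[xu yu]] _] := tdW.
  by case: (ltnP (pos u) (pos t)) => ut; [apply: yN|apply: xN]; exists u.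
apply: leq_ltn_trans (ltWk t); apply: subset_leq_card; apply/subsetP => x.
rewrite in_setI => /andP[/in_cut1[t1 lt1 x1] /in_cut2[t2 le2 x2]].
apply: (subsetP (@bag_convex t1 t t2 _)); last by rewrite inE x1.
by rewrite (ltnW lt1).
Qed.

Lemma cut_mono i j : i <= j -> sep_le (cut i) (cut j).
Proof.
move=> ij; apply/andP; split; apply/subsetP => x.
  by case/in_cut1=> t ti xt; apply/in_cut1; exists t => //; apply: leq_trans ij.
by case/in_cut2=> t ti xt; apply/in_cut2; exists t => //; apply: leq_trans ti.
Qed.

Definition cut_label x y : osep G :=
  if pos x < pos y then cut (pos y) else inv (cut (pos x)).

Lemma cut_Stree : Stree_over (calF2 k) k cut_label.
Proof.
have [tT _ _ _] := tdW.
have labS x y : cut_label x y \in vecS G k.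
  by rewrite /cut_label; case: ifP => _; rewrite ?inv_vecS; apply: cut_vecS.
split=> // [x y|t].
  by rewrite pos_adj /cut_label => xy; case: ltnP => h1; case: ltnP => h2 //; lia.
set sigma := [set _ | _ in _].
have sigmaE s : s \in sigma -> s = cut (pos t) \/ s = inv (cut (pos t).+1).
  case/imsetP=> x; rewrite inE pos_adj /cut_label => xt ->.
  by case: ltnP => h; [left|right; congr (inv (cut _)); lia].
(* The label [cut (pos t)] occurs at [t] only if [t] has a left neighbour, which exists because [u]
   precedes [t]. *)
have lower x u : pos u < pos t -> x \in \bigcap_(s in sigma) s.2 -> x \in (cut (pos t)).2.
  move=> ut /bigcapP; apply; have [|v ev] := @pos_down t (pos t).-1; first by lia.
  apply/imsetP; exists v; first by rewrite inE pos_adj ev; lia.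
  by rewrite /cut_label ev ifT //; lia.
have upper x u : pos t < pos u -> x \in \bigcap_(s in sigma) s.2 -> x \in (cut (pos t).+1).1.
  move=> tu /bigcapP h; have [v ev] := pos_down tu.
  suff /h : inv (cut (pos t).+1) \in sigma by [].
  apply/imsetP; exists v; first by rewrite inE pos_adj ev eqxx orbT.
  by rewrite /cut_label ev ifF //; lia.
split; last first.
  apply: (@leq_trans #|[set cut (pos t); inv (cut (pos t).+1)]|); last first.
    by rewrite cards2; case: eqP.
  apply: subset_leq_card; apply/subsetP => s /sigmaE.
  by rewrite in_set2 => -[]->; rewrite eqxx ?orbT.
split.
  split=> [|s /imsetP[x _ ->]|s r /sigmaE sE /sigmaE rE sr].
  - by apply/subsetP => s /imsetP[x _ ->]; have := labS x t; rewrite vecSE => /andP[].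
  (* A self-inverse label would be (V,V), whose order |V| is at least [k]. *)
  - move: (cut_label x t) (labS x t) => r; rewrite vecSE => /andP[rr rk].
    apply/eqP => ri; have r12 : r.1 = r.2 by rewrite {1}ri.
    have := card_osep rr; move: rk; rewrite /order r12 setIid; lia.
  - case: sE rE sr => -> [] -> ; rewrite ?eqxx // => _.
      by rewrite invK; apply: cut_mono.
    by rewrite sep_le_inv; apply: cut_mono.
apply: leq_ltn_trans (ltWk t); apply: subset_leq_card; apply/subsetP => x xI.
(* If the bag of [u] is on one side of [t], the intersection puts [x] also in a bag at [t] or on the
   other side, and convexity in [W t]. *)
have [u xu] := in_some_bag x.
case: (ltngtP (pos u) (pos t)) => [ut|tu|/pos_inj <- //].
  have /in_cut2[v tv xv] := lower x u ut xI.
  by apply: (subsetP (@bag_convex u t v _)); rewrite ?inE ?xu // tv ltnW.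
have /in_cut1[v vt xv] := upper x u tu xI.
by apply: (subsetP (@bag_convex v t u _)); rewrite ?inE ?xu ?xv // (ltnW tu) andbT.
Qed.

End TreeFromDecomposition.

(** * Blockages, tangles and S_k-trees *)

Section Equivalences.
Variables (G : sgraph) (k : nat).

Lemma calF2_set0 : #|G| < k -> calF2 k (set0 : {set osep G}).
Proof.
by move=> Gk; split; [split; [split=> [|s|s r]|]|]; rewrite ?sub0set ?inE ?big_set0 ?cardsT ?cards0.
Qed.

Lemma pathwidth_Stree : 0 < #|G| -> pathwidth G < k - 1 ->
  exists (T : sgraph) (alpha : T -> T -> osep G), Stree_over (calF2 k) k alpha.
Proof.
(* For |V| < k the empty star is in F_k and a single node suffices; otherwise [k <= #|G|] keeps
   (V,V) out of the labels. *)
move=> G0 pw; case: (ltnP #|G| k) => [Gk|kG].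
  exists (path_graph 0), (fun _ _ => (set0, setT)).
  have noadj (x y : path_graph 0) : ~~ adj x y by rewrite !ord1 adj_irrefl.
  split=> [|x y xy|x y xy|t]; first exact: path_graph_is_tree.
  - by have := noadj x y; rewrite xy.
  - by have := noadj x y; rewrite xy.
  - rewrite (_ : [set _ | _ in _] = set0); first exact: calF2_set0.
    by apply/setP => s; rewrite inE; apply/imsetP => -[x]; rewrite inE (negPf (noadj _ _)).
have [T [W [td [n [f [[g fK gK] adjf]]] wW]]] := pathwidth_decomposition G.
exists T, (cut_label W (fun t => g t)); apply: cut_Stree => //.
- move=> t; have := @leq_bigmax T (fun t => #|W t|) t.
  move: wW pw; rewrite /width; lia.
- by move=> x y /val_inj/(can_inj gK).
- by move=> x y; rewrite -{1}[x]gK -{1}[y]gK adjf.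
- move=> t m mt; have lt_m : m < n.+1 by apply: leq_ltn_trans mt _.
  by exists (f (Ordinal lt_m)); rewrite fK.
Qed.

(** Smaller stars are padded with (0,V), whose second side leaves the intersection unchanged; [s]
    and [r] may coincide. *)
Lemma calF2_pair (O sigma : {set osep G}) : (set0, setT) \in O ->
    calF2 k sigma -> sigma \subset O ->
  exists s r, [/\ s \in O, r \in O, sep_le s (inv r) & #|s.2 :&: r.2| < k].
Proof.
move=> O0 [[[_ _ st] ltk] le2] /subsetP sO.
move: le2; rewrite leq_eqVlt ltnS leq_eqVlt ltnS leqn0.
case/or3P=> [/cards2P[s [r [sr e]]]|/cards1P[s e]|].
- exists s, r; rewrite !sO ?e ?in_set2 ?eqxx ?orbT //; split=> //.
    by apply: st; rewrite // e in_set2 eqxx ?orbT.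
  by move: ltk; rewrite e big_setU1 ?inE //= big_set1.
- exists s, (set0, setT); rewrite sO ?e ?set11 //; split=> //.
    by rewrite /sep_le subsetT sub0set.
  by move: ltk; rewrite e big_set1 setIT.
- rewrite cards_eq0 => /eqP e; exists (set0, setT), (set0, setT); split=> //.
    exact: set0T_le.
  by move: ltk; rewrite e big_set0 setIT.
Qed.

Lemma blockage_tangle (B : {set {set G}}) : 0 < #|G| -> 0 < k -> blockage k B ->
  tangle (calF2 k) k [set s in vecS G k | s.1 \in B].
Proof.
move=> /card_gt0P[x0 _] k0 [bdB downB oneB].
have oneP s : s \in vecS G k ->
    (s.1 \in B) || (s.2 \in B) /\ (s.1 \in B -> s.2 \in B -> s.1 = s.2).
  by move=> /oneB/card_setI2_eq1.
have [] := oneP _ (set0T_vecS G k0); rewrite /= => zT zTe.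
have B0 : set0 \in B.
  case/orP: zT => // /downB; apply; rewrite ?sub0set //.
  exact: boundary_order (set0T_vecS G k0).
have BT : setT \notin B.
  by apply/negP => /(zTe B0)/setP/(_ x0); rewrite !inE.
have memO s : (s \in [set s in vecS G k | s.1 \in B]) = (s \in vecS G k) && (s.1 \in B).
  by rewrite in_set.
(* Two sides in [B] must be equal, hence both V, which is not in [B]. *)
have both s : s \in vecS G k -> s.1 \in B -> s.2 \notin B.
  move=> sS s1; apply/negP => s2; have e := (oneP s sS).2 s1 s2.
  move: sS; rewrite vecSE => /andP[/osepsP[cov _] _]; case/negP: BT.
  rewrite (_ : setT = s.1) //; apply/setP => x; rewrite inE.
  by have := cov x; rewrite -e orbb.
split.
- split; first by apply/subsetP => s; rewrite memO => /andP[].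
  move=> s sS; apply/card_setI2_eq1; rewrite !memO inv_vecS sS /=.
  split; first exact: (oneP s sS).1.
  by move=> /(both s sS)/negP.
- case=> s [r] [[sS rS] _ /andP[_ /andP[sr _]]]; rewrite !memO.
  case/andP=> _ s2 /andP[_ r1]; have isS : inv s \in vecS G k by rewrite inv_vecS.
  by have /negP[] := both _ isS s2; apply: downB r1 sr (boundary_order sS).
- move=> sigma sO sF; have [] := calF2_pair _ sF sO.
    by rewrite memO set0T_vecS.
  move=> s [r] [+ + sr ord]; rewrite !memO => /andP[sS s1] /andP[rS r1].
  (* By (B3) one of [s.2], [r.2] is then in [B], but [s.1] and [r.1] already are. *)
  have mS : (s.2, r.2) \in vecS G k.
    rewrite vecSE /order ord andbT -(inv_oseps (_, _)).
    apply: (@nested_oseps G s (inv r)) => //; rewrite ?inv_oseps.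
      by move: sS; rewrite vecSE => /andP[].
    by move: rS; rewrite vecSE => /andP[].
  by have [/orP[]/= h _] := oneP _ mS; [have := both s sS s1|have := both r rS r1]; rewrite h.
Qed.

(* The tangle orients some edge away from every node; following these edges
   ends in a cycle of the tree. *)
Lemma tangle_no_Stree (O : {set osep G}) (T : sgraph) (alpha : T -> T -> osep G) :
  tangle (calF2 k) k O -> ~ Stree_over (calF2 k) k alpha.
Proof.
move=> [[subO oneO] _ avoidO] [[T0 _ acT] alphaS alphaI alphaF].
have kG : k <= #|G|.
  by rewrite leqNgt; apply/negP => /calF2_set0/avoidO; apply; rewrite sub0set.
(* The labels into [t] form a forbidden star, so one of them is not in [O]; its inverse points out
   of [t]. *)
have out t : exists x, adj t x && (alpha t x \in O).
  have /subsetPn[s /imsetP[x + ->] xO] : ~~ ([set alpha x t | x : T & adj x t] \subset O).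
    by apply/negP => /avoidO; apply.
  rewrite inE => xt; have tx : adj t x by rewrite adj_sym.
  exists x; rewrite tx (alphaI x t xt) /=.
  have /card_setI2_eq1[] := oneO _ (alphaS _ _ xt).
  by rewrite (negPf xO).
pose f t := xchoose (out t).
have fP t : adj t (f t) && (alpha t (f t) \in O) := xchooseP (out t).
have /card_gt0P[t0 _] := T0.
(* The iterate of index [order f t0] equals an earlier one, [y], so [f] cycles from [y] on. *)
have /trajectP[i ilt ei] := looping_order f t0.
set y := iter i f t0 in ei.
have cyc : fcycle f (orbit f y).
  apply/(orbitPcycle 0 3); exists (fingraph.order f t0 - i).-1.
  by rewrite prednK ?subn_gt0 // -iterD subnK // ltnW.
have oc : cycle (@adj T) (orbit f y).
  by apply: sub_cycle cyc => u v /eqP <-; case/andP: (fP u).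
have noloop u : f u != u by apply: contraTneq (andP (fP u)).1 => e; rewrite e adj_irrefl.
(* [acyclic] only excludes cycles of length above 2. If [f] swapped [u] and [f u], then [O] would
   contain a separation and its inverse, which forces (V,V), of order |V| >= k. *)
have nodigon u : f (f u) != u.
  apply/eqP => e; have /andP[ufu uO] := fP u; have := fP (f u); rewrite e => /andP[_].
  have uS := alphaS _ _ ufu; rewrite (alphaI _ _ ufu) => iO.
  have /card_setI2_eq1[_ /(_ uO iO) ri] := oneO _ uS.
  move: (alpha u (f u)) uS ri => r; rewrite vecSE => /andP[rr rk] ri.
  have r12 : r.1 = r.2 by rewrite {1}ri.
  have := card_osep rr; move: rk; rewrite /order r12 setIid; lia.
apply: (acT (orbit f y)); last by rewrite /ucycle oc orbit_uniq.
move: cyc; rewrite size_orbit /orbit.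
case: (fingraph.order f y) (order_gt0 f y) => // -[|[|m]] // _ /=.
  by rewrite andbT (negPf (noloop y)).
by rewrite eqxx andbT (negPf (nodigon y)).
Qed.

End Equivalences.

Theorem theorem7p2 (G : sgraph) (k : nat) (hG : 0 < #|G|) (hk : 0 < k) :
  [<-> exists B : {set {set G}}, blockage k B;
       exists O : {set osep G}, tangle (calF2 k) k O;
       ~ exists (T : sgraph) (alpha : T -> T -> osep G),
           Stree_over (calF2 k) k alpha;
       k - 1 <= pathwidth G].
Proof.
tfae.
- by case=> B /(blockage_tangle hG hk) tO; eexists; apply: tO.
- by case=> O tO [T [alpha]]; apply: tangle_no_Stree tO.
- by move=> noT; rewrite leqNgt; apply/negP => /(pathwidth_Stree hG).
- move=> pw; apply: unreachable_blockage => //.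
  by apply: contraL pw => /(reachable_pathwidth hG); rewrite -ltnNge.
Qed.
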